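(* Let $\Psi$ be a circle of pseudo-arcs, with open atomic map $\Pi:\Psi\to S^1$ whose point-inverses $P_\alpha=\Pi^{-1}(e^{i\alpha})$, $\alpha\in[0,2\pi)$, are terminal pseudo-arcs, so that $\Psi=\bigcup_{\alpha\in[0,2\pi)}P_\alpha$. Then the Planck boundary $\mathcal{P}=\mathcal{A}\cap\overline{\mathcal{F}}$ of $C(\Psi)$ is a continuum in $C(\Psi)$ consisting of the minimal ample subcontinua of $\Psi$, and these are exactly the terminal pseudo-arcs of the decomposition: $\mathcal{P}=\{P_\alpha:\alpha\in[0,2\pi)\}$.
   Context: A continuum is a non-empty compact connected metric space; it is degenerate if it consists of one point. A subcontinuum of $X$ is a non-empty compact connected subset of $X$. For a continuum $X$, $C(X)$ denotes the hyperspace of all subcontinua of $X$ with the Hausdorff metric. A map is a continuous function. A subcontinuum $K\subset X$ is terminal in $X$ if for every subcontinuum $L\subset X$ with $K\cap L\neq\emptyset$ either $K\subset L$ or $L\subset K$. A map $f:X\to Y$ between continua is atomic if all point-inverses are terminal subcontinua of $X$, and open if it sends open sets to open sets. A continuum $X$ is decomposable if $X=A\cup B$ for some proper subcontinua $A,B$ of $X$, indecomposable otherwise, and hereditarily indecomposable if each of its subcontinua is indecomposable. A continuum $X$ is chainable if for every $\varepsilon>0$ there is a finite open cover $C_1,\dots,C_n$ of $X$ with $\operatorname{diam} C_k<\varepsilon$ for all $k$ and with $C_k\cap C_l\neq\emptyset$ if and only if $|k-l|\le 1$. A pseudo-arc is a non-degenerate, chainable, hereditarily indecomposable continuum (by a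 theorem of Bing any two are homeomorphic). A circle of pseudo-arcs is a continuum homeomorphic to the example constructed by Bing and Jones (1959), which is a homogeneous (its homeomorphism group acts transitively), decomposable, nowhere locally connected plane continuum admitting an open atomic map onto $S^1$ all of whose point-inverses are pseudo-arcs. For a continuum $X$, a subcontinuum $K\in C(X)$ is filament if there is an open set $U\subset X$ with $K\subset U$ such that the component of $U$ containing $K$ has empty interior. $K\in C(X)$ is ample if for every open set $U\subset X$ with $K\subset U$ there is $L\in C(X)$ with $K\subset\operatorname{int}(L)\subset L\subset U$. (In a homogeneous continuum a subcontinuum is ample if and only if it is not filament.) Here $\mathcal{F}$ and $\mathcal{A}$ denote the sets of filament and of ample subcontinua of $\Psi$, respectively, and $\overline{\mathcal{F}}$ is the closure of $\mathcal{F}$ in $C(\Psi)$. A minimal ample subcontinuum is an ample subcontinuum no proper subcontinuum of which is ample. *)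

(* Defs.v *)
From HB Require Import structures.
From mathcomp Require Import all_boot all_order all_algebra.
From mathcomp Require Import all_classical all_reals all_analysis.

Set Implicit Arguments.
Unset Strict Implicit.
Unset Printing Implicit Defensive.

Import Order.TTheory GRing.Theory Num.Theory.
Import numFieldNormedType.Exports.

Local Open Scope classical_set_scope.
Local Open Scope ring_scope.

Section Continua.
Context {T : topologicalType}.
Implicit Types K L A B U V : set T.

(* The ambient space [T] is itself a continuum when [continuum [set: T]]; all
   the spaces considered below are metric. *)
Definition continuum K := [/\ K !=set0, compact K & connected K].

Definition nondegenerate K := exists x y, [/\ K x, K y & x <> y].

Definition terminal K := continuum K /\
  forall L, continuum L -> K `&` L !=set0 -> K `<=` L \/ L `<=` K.

Definition decomposable K := exists A B,
  [/\ continuum A, continuum B, A `<` K, B `<` K & K = A `|` B].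

Definition hereditarily_indecomposable K :=
  forall L, continuum L -> L `<=` K -> ~ decomposable L.

Definition locally_connected_at (x : T) := forall U, nbhs x U ->
  exists V, [/\ open V, V x, connected V & V `<=` U].

Definition nowhere_locally_connected := forall x : T, ~ locally_connected_at x.

(* As [K] is connected, the component of [U] containing [K] is the component
   in [U] of any point [x] of [K]. *)
Definition filament K := continuum K /\ exists U,
  [/\ open U, K `<=` U &
      forall x, K x -> (connected_component U x)° = set0].

Definition ample K := continuum K /\ forall U, open U -> K `<=` U ->
  exists L, [/\ continuum L, K `<=` L° & L `<=` U].

Definition minimal_ample K := ample K /\ forall L, L `<` K -> ~ ample L.

End Continua.
Arguments nowhere_locally_connected T : clear implicits.

Section Maps.
Context {T U : topologicalType}.

Definition open_map (f : T -> U) := forall A, open A -> open (f @` A).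

Definition atomic (f : T -> U) :=
  continuous f /\ forall y, terminal (f @^-1` [set y]).

Definition homeomorphism (f : T -> U) := continuous f /\
  exists g : U -> T, [/\ continuous g, cancel f g & cancel g f].

End Maps.

Definition homogeneous (T : topologicalType) :=
  forall x y : T, exists2 h : T -> T, homeomorphism h & h x = y.

Section Circle.
Variable R : realType.

Definition planar (T : topologicalType) :=
  exists (A : set (R * R)) (h : T -> A), homeomorphism h.

Definition unit_circle : set (R * R) := [set z | z.1 ^+ 2 + z.2 ^+ 2 = 1].

Lemma expi_subproof (a : R) : (cos a, sin a) \in unit_circle.
Proof. by apply/mem_set; rewrite /unit_circle/= cos2Dsin2. Qed.

(* [expi a] is e^(i a), the complex plane being identified with [R * R]. *)
Definition expi (a : R) : unit_circle := exist _ (cos a, sin a) (expi_subproof a).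

End Circle.
Arguments planar R T : clear implicits.
Arguments unit_circle R : clear implicits.

Section PseudoArcs.
Context {R : realType} {X : metricType R}.
Implicit Types K A : set X.

Definition diam A : \bar R :=
  ereal_sup [set (mdist x.1 x.2)%:E | x in A `*` A].

(* The links [C k] are subsets of [K] that are relatively open in [K]. *)
Definition chainable K := forall e : R, 0 < e ->
  exists n (C : 'I_n -> set X),
    [/\ forall k, exists2 U, open U & C k = K `&` U,
        K = \bigcup_k C k,
        forall k, (diam (C k) < e%:E)%E &
        forall k l : 'I_n,
          C k `&` C l !=set0 <-> (k <= l.+1)%N && (l <= k.+1)%N].

Definition pseudo_arc K :=
  [/\ continuum K, nondegenerate K, chainable K & hereditarily_indecomposable K].

End PseudoArcs.

(* The decomposition structure carried by a circle of pseudo-arcs. *)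
Definition pseudo_arc_fibration (R : realType) (X : metricType R)
    (f : X -> unit_circle R) :=
  [/\ atomic f, open_map f & forall y, pseudo_arc (f @^-1` [set y])].

(* The Bing-Jones example is specified here by the properties it was constructed
   to have.  By the Hoehn-Oversteegen classification, a nondegenerate
   homogeneous plane continuum is a circle, a pseudo-arc or a circle of
   pseudo-arcs; the first is locally connected and the second indecomposable, so
   these properties determine the example up to homeomorphism. *)
Definition circle_of_pseudo_arcs (R : realType) (X : metricType R) :=
  [/\ continuum [set: X],
      homogeneous X,
      decomposable [set: X],
      nowhere_locally_connected X &
      planar R X /\ exists f : X -> unit_circle R, pseudo_arc_fibration f].

Section Hausdorff.
Context {R : realType} {X : metricType R}.
Implicit Types (x y : X) (A B C : set X).

Definition point_dist x A : R := inf [set mdist x y | y in A].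

Definition excess A B : R := sup [set point_dist x B | x in A].

Definition hausdorff_dist A B : R := Num.max (excess A B) (excess B A).

Lemma point_dist_has_inf x A : A !=set0 -> has_inf [set mdist x y | y in A].
Proof.
move=> [a Aa]; split; first by exists (mdist x a), a.
by exists 0 => _ [y _ <-]; exact: mdist_ge0.
Qed.

Lemma point_dist_le x A y : A y -> point_dist x A <= mdist x y.
Proof.
move=> Ay; apply: ge_inf; last by exists y.
by have [] := @point_dist_has_inf x A (ex_intro _ _ Ay).
Qed.

Lemma point_dist_ge x A (r : R) : A !=set0 ->
  (forall y, A y -> r <= mdist x y) -> r <= point_dist x A.
Proof.
move=> A0 h; apply: lb_le_inf; first by have [] := point_dist_has_inf x A0.
by move=> _ [y Ay <-]; exact: h.
Qed.

Lemma point_dist_ge0 x A : A !=set0 -> 0 <= point_dist x A.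
Proof. by move=> A0; apply: point_dist_ge => // y _; exact: mdist_ge0. Qed.

Lemma point_dist_triangle x y A : A !=set0 ->
  point_dist x A <= mdist x y + point_dist y A.
Proof.
move=> A0; rewrite -lerBlDl; apply: point_dist_ge => // z Az.
by rewrite lerBlDl (le_trans (point_dist_le x Az))// metric_triangle.
Qed.

Lemma mdist_continuous x : continuous (mdist x : X -> R).
Proof.
move=> y; apply/cvgrPdist_lt => e e0.
have : nbhs y (ball y e) by exact: nbhsx_ballx.
apply: filterS => z; rewrite ballEmdist/= => yz.
rewrite (le_lt_trans _ yz)// ler_norml; apply/andP; split.
  by rewrite lerBrDl lerBlDr metric_triangle.
by rewrite lerBlDr addrC (le_trans (metric_triangle x z y))// (metric_sym z).
Qed.

Lemma compact_mdist_bounded x A : compact A ->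
  exists M, forall y, A y -> mdist x y <= M.
Proof.
move=> cA; have cmA : compact (mdist x @` A).
  apply: continuous_compact => //; apply: continuous_subspaceT.
  exact: mdist_continuous.
have [M [_ hM]] := compact_bounded cmA.
exists (M + 1) => y Ay.
apply: le_trans (ler_norm _) _; apply: (hM (M + 1)); last by exists y.
by rewrite ltrDl.
Qed.

Lemma excess_has_sup A B : continuum A -> continuum B ->
  has_sup [set point_dist x B | x in A].
Proof.
move=> [[a Aa] cA _] [[b Bb] cB _]; split; first by exists (point_dist a B), a.
have [M hM] := compact_mdist_bounded b cA.
exists M => _ [x Ax <-]; rewrite (le_trans (point_dist_le x Bb))//.
by rewrite metric_sym hM.
Qed.

Lemma excess_ge A B x : continuum A -> continuum B -> A x ->
  point_dist x B <= excess A B.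
Proof.
move=> cA cB Ax; apply: ub_le_sup; last by exists x.
by have [] := excess_has_sup cA cB.
Qed.

Lemma excess_le A B (r : R) : A !=set0 ->
  (forall x, A x -> point_dist x B <= r) -> excess A B <= r.
Proof.
move=> [a Aa] h; apply: ge_sup; first by exists (point_dist a B), a.
by move=> _ [x Ax <-]; exact: h.
Qed.

Lemma excess_ge0 A B : continuum A -> continuum B -> 0 <= excess A B.
Proof.
move=> cA cB; have [[a Aa] _ _] := cA; have [B0 _ _] := cB.
exact: le_trans (point_dist_ge0 a B0) (excess_ge cA cB Aa).
Qed.

Lemma excessxx A : continuum A -> excess A A = 0.
Proof.
move=> cA; apply/eqP; rewrite eq_le excess_ge0// andbT.
have [A0 _ _] := cA; apply: excess_le => // x Ax.
by rewrite -(mdistxx x) point_dist_le.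
Qed.

Lemma excess_triangle A B C : continuum A -> continuum B -> continuum C ->
  excess A C <= excess A B + excess B C.
Proof.
move=> cA cB cC; have [A0 _ _] := cA; have [B0 _ _] := cB.
have [C0 _ _] := cC; apply: excess_le => // x Ax.
rewrite -lerBlDr (le_trans _ (excess_ge cA cB Ax))//.
apply: point_dist_ge => // y By; rewrite lerBlDr.
by rewrite (le_trans (point_dist_triangle x y C0))// lerD2l excess_ge.
Qed.

Lemma excess0_subset A B : continuum A -> continuum B ->
  excess A B = 0 -> A `<=` B.
Proof.
move=> cA cB AB0 x Ax; have [B0 coB _] := cB.
have clB : closed B by exact: compact_closed (@metric_hausdorff _ X) coB.
apply: clB => U /nbhs_ballP[e /= e0 xeU].
have : point_dist x B < e.
  by rewrite (le_lt_trans (excess_ge cA cB Ax))// AB0.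
move=> /(inf_lt (point_dist_has_inf x B0).1)[_ [y By <-] xy].
by exists y; split => //; apply: xeU; rewrite ballEmdist.
Qed.

End Hausdorff.

(* The hyperspace C(X), with the Hausdorff metric. *)
Record hyperspace (R : realType) (X : metricType R) := Hyperspace {
  hyperset :> set X ;
  hyperset_continuum : continuum hyperset }.

HB.instance Definition _ (R : realType) (X : metricType R) :=
  gen_eqMixin (hyperspace X).
HB.instance Definition _ (R : realType) (X : metricType R) :=
  gen_choiceMixin (hyperspace X).

Section HyperspaceMetric.
Context {R : realType} {X : metricType R}.
Implicit Types K L M : hyperspace X.

Let hdist K L : R := hausdorff_dist K L.

Lemma hyperset_inj : injective (@hyperset R X).
Proof.
move=> [A cA] [B cB] /= AB; case: _ / AB in cB *.
by congr Hyperspace; exact: Prop_irrelevance.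
Qed.

Let hdistxx K : hdist K K = 0.
Proof. by rewrite /hdist/hausdorff_dist excessxx ?maxxx//; case: K. Qed.

Let hdist_positivity K L : hdist K L = 0 -> K = L.
Proof.
have cK := hyperset_continuum K; have cL := hyperset_continuum L.
move=> KL0; apply: hyperset_inj; apply/seteqP.
have le0 (A B : set X) : continuum A -> continuum B ->
    excess A B <= hdist K L -> A `<=` B.
  move=> cA cB; rewrite KL0 => AB; apply: excess0_subset => //.
  by apply/eqP; rewrite eq_le AB excess_ge0.
by split; apply: le0 => //; rewrite /hdist/hausdorff_dist le_max lexx ?orbT.
Qed.

Let hdist_sym K L : hdist K L = hdist L K.
Proof. by rewrite /hdist/hausdorff_dist maxC. Qed.

Let hdist_triangle L K M : hdist K M <= hdist K L + hdist L M.
Proof.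
have cK := hyperset_continuum K; have cL := hyperset_continuum L.
have cM := hyperset_continuum M.
rewrite /hdist/hausdorff_dist ge_max; apply/andP; split.
  by rewrite (le_trans (excess_triangle cK cL cM))// lerD// le_max lexx.
rewrite (le_trans (excess_triangle cM cL cK))// addrC.
by rewrite lerD// le_max lexx orbT.
Qed.

HB.instance Definition _ := isMetric.Build R (hyperspace X)
  hdistxx hdist_positivity hdist_sym hdist_triangle.

End HyperspaceMetric.

Section Planck.
Context {R : realType} (X : metricType R).

Definition filaments : set (hyperspace X) := [set K | filament K].
Definition amples : set (hyperspace X) := [set K | ample K].
Definition planck_boundary : set (hyperspace X) := amples `&` closure filaments.

End Planck.
Arguments planck_boundary {R} X.
Arguments filaments {R} X.
Arguments amples {R} X.

(* Main.v *)
Require Import Defs.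
From HB Require Import structures.
From mathcomp Require Import all_boot all_order all_algebra.
From mathcomp Require Import all_classical all_reals all_analysis.
From mathcomp Require Import ring lra.
Import Order.TTheory GRing.Theory Num.Theory.
Import numFieldNormedType.Exports.
Local Open Scope classical_set_scope.
Local Open Scope ring_scope.
Set Implicit Arguments.
Unset Strict Implicit.
Unset Printing Implicit Defensive.

(** Let [f] be an open atomic map of a compact metric space [X] onto the circle,
    with nondegenerate indecomposable fibers; the pseudo-arcs of the
    decomposition are such fibers.

    A fiber is ample, because [f] is a closed map with connected fibers: the
    preimage of a small arc around [y] is a subcontinuum close to the fiber of
    [y] and a neighborhood of it ([fiber_ample]).  A proper subcontinuum [K] of
    a fiber is filament: choose a point [p] of the fiber outside [K] and an open
    set containing [K] whose closure misses [p].  A continuum that stays in this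
    closure and meets the fiber cannot contain the fiber, hence by terminality
    lies in it; and fibers have empty interior because [f] is open
    ([terminal_sub_filament]).  No ample continuum is filament, and by
    terminality a continuum either lies properly in a fiber or contains a fiber.
    So the filament continua are exactly the proper subcontinua of fibers, every
    ample continuum contains a fiber, and the minimal ample ones are the fibers
    ([filament_fiberP], [minimal_ample_fiberP]).

    On a filament continuum [f] is constant, hence also on a limit of such
    continua; an ample limit lies in a fiber and contains it, so it is a fiber.
    Conversely each fiber is a limit of its proper subcontinua: by boundary
    bumping the proper subcontinua through a given point reach near every other
    point, and in an indecomposable continuum finitely many of them
    have a proper union ([indecomposable_approx]).  This identifies the Planck
    boundary with the set of fibers ([planck_boundary_fiberP]).  It is a
    continuum because sending [y] to its fiber is continuous for the Hausdorff
    metric, upper semicontinuity being the closedness of [f] and lower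
    semicontinuity its openness ([fibers_continuous]). *)

(** * Continua in compact Hausdorff spaces *)

Lemma continuous_eq_cluster (T U : topologicalType) (f : T -> U) (p q : T) :
  hausdorff_space U -> continuous f -> cluster (nbhs p) q -> f p = f q.
Proof.
move=> hU cf pq; apply: hU => A B pA qB.
by have [z [Az Bz]] := pq _ _ (cf _ _ pA) (cf _ _ qB); exists (f z).
Qed.

Lemma closed_map_compact (T U : topologicalType) (f : T -> U) (A : set T) :
  compact [set: T] -> hausdorff_space U -> continuous f -> closed A ->
  closed (f @` A).
Proof.
move=> cT hU cf clA; apply: compact_closed => //; apply: continuous_compact.
  exact: continuous_subspaceT.
exact: subclosed_compact clA cT (@subsetT _ _).
Qed.

Lemma separated_closed (T : topologicalType) (A B C : set T) :
  closed C -> C = A `|` B -> separated A B -> closed A.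
Proof.
move=> clC CE [AB _] x Ax.
have : closure C x by move: x Ax; apply: closureS; rewrite CE; exact: subsetUl.
rewrite -(closure_id C).1// CE => -[//|Bx].
by have : (closure A `&` B) x by []; rewrite AB.
Qed.

(** For a closed [Y] these are the clopen sets of the subspace [Y]: asking that
    both pieces be closed in [T] avoids the subspace topology. *)
Definition relatively_clopen (T : topologicalType) (Y F : set T) :=
  [/\ F `<=` Y, closed F & closed (Y `\` F)].

Definition quasi_component (T : topologicalType) (Y : set T) (p : T) :=
  \bigcap_(F in [set F | relatively_clopen Y F /\ F p]) F.

(** Compactness: if every relatively clopen [F] containing [p] left [O], the
    sets [F `\` O] would form a filter base on [Y], and a cluster point of it
    would lie in the quasi-component but not in [O]. *)
Lemma quasi_component_nbhs (T : topologicalType) (Y O : set T) (p : T) :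
  hausdorff_space T -> compact Y -> Y p -> open O ->
  quasi_component Y p `<=` O ->
  exists F, [/\ relatively_clopen Y F, F p & F `<=` O].
Proof.
move=> hT cY Yp oO QO; have clY : closed Y by exact: compact_closed.
apply: contrapT => /forallNP noF.
pose D := [set F | relatively_clopen Y F /\ F p].
pose G := filter_from D (fun F => F `\` O).
have FG : ProperFilter G.
  apply: filter_from_proper; first apply: filter_from_filter.
  - by exists Y; split=> //; split=> //; rewrite setDv; exact: closed0.
  - move=> E F [[EY clE cE] Ep] [[FY clF cF] Fp]; exists (E `&` F).
      split=> //; split; first by move=> x [/EY].
        exact: closedI.
      by rewrite setDIr; exact: closedU.
    by move=> x [[? ?] ?].
  - move=> F [cF Fp]; apply/set0P/eqP => FO; apply: (noF F); split => //.
    by rewrite -setD_eq0.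
have GY : G Y.
  exists Y; last by move=> x [].
  by split=> //; split=> //; rewrite setDv; exact: closed0.
have [x [Yx Gx]] := cY G _ GY.
have cl F : D F -> closure (F `\` O) x.
  by move=> DF B xB; apply: Gx => //; exists F.
have Ox : O x.
  apply: QO => F [cF Fp]; have [_ clF _] := cF.
  by apply: clF; apply: closureS (cl F _) => // z [].
have DY : D Y by split=> //; split=> //; rewrite setDv; exact: closed0.
have [z [[_ +] Oz]] := cl Y DY O (open_nbhs_nbhs (conj oO Ox)).
exact.
Qed.

(** A splitting of the quasi-component into two closed pieces is separated by
    disjoint open sets [V] and [W]; a relatively clopen [F] inside [V `|` W] is
    cut by [V] into a smaller relatively clopen set, which must still contain the
    whole quasi-component. *)
Lemma quasi_component_connected (T : topologicalType) (Y : set T) (p : T) :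
  hausdorff_space T -> compact [set: T] -> closed Y -> Y p ->
  connected (quasi_component Y p).
Proof.
move=> hT cT clY Yp.
have cY : compact Y by exact: subclosed_compact clY cT (@subsetT _ _).
have clQ : closed (quasi_component Y p).
  by apply: closed_bigI => F [[]].
have Qp : quasi_component Y p p by move=> F [].
apply: contrapT => /connectedPn[E [E0 QE sE]].
wlog E0p : E E0 QE sE / E false p.
  move=> H; have : (E false `|` E true) p by rewrite -QE.
  case=> [|Ep]; first exact: H.
  by apply: (H (E \o negb)) => //=; rewrite 1?setUC 1?separatedC.
have cl0 : closed (E false) by exact: separated_closed clQ QE sE.
have cl1 : closed (E true).
  by apply: (separated_closed clQ (B := E false));
    [rewrite QE setUC|rewrite separatedC].
have dE : E false `&` E true = set0 by exact: separated_disjoint.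
have : set_nbhs (E false) (~` E true).
  apply/set_nbhsP; exists (~` E true); split=> //; first exact: closed_openC.
  by apply/disjoints_subset.
case/(compact_normal hT cT cl0) => B /set_nbhsP[V [oV EV VB]] BE.
pose W := ~` closure B.
have oW : open W by apply: closed_openC; exact: closed_closure.
have EW : E true `<=` W by apply: subsetCr.
have VW z : V z -> W z -> False by move=> /VB /subset_closure.
have [|F [[FY clF cF] Fp FO]] := quasi_component_nbhs hT cY Yp (openU oV oW).
  by rewrite QE; exact: setUSS.
have [x Ex] := E0 true.
have : (F `&` V) x.
  have : quasi_component Y p x by rewrite QE; right.
  apply; split; last by split=> //; exact: EV.
  split; first by move=> z [/FY].
    rewrite (_ : _ `&` _ = F `\` W); last first.
      apply/seteqP; split=> z [Fz zV]; split=> //; first exact: VW zV.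
      by case: (FO z Fz).
    by rewrite setDE; apply: closedI => //; exact: open_closedC.
  rewrite (_ : _ `\` _ = (Y `\` F) `|` (F `\` V)).
    apply: closedU => //; rewrite setDE; apply: closedI => //.
    exact: open_closedC.
  rewrite setDIr; apply/seteqP; split=> z [|[? ?]]; [by left| |by left|].
    by have [Fz|] := pselect (F z); [right|left].
  by right; split=> //; exact: FY.
by case=> _ Vx; apply: (VW x) => //; exact: EW.
Qed.

(** Otherwise the quasi-component of [p], which lies in its component, would have
    a relatively clopen neighborhood in [K `\` V] away from [closure V]; that
    neighborhood would be clopen in the connected set [K]. *)
Lemma boundary_bumping (T : topologicalType) (K V : set T) (p : T) :
  hausdorff_space T -> compact [set: T] -> continuum K ->
  open V -> K `&` V !=set0 -> K p -> ~ V p ->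
  connected_component (K `\` V) p `&` closure V !=set0.
Proof.
move=> hT cT [_ cK ctdK] oV [v [Kv Vv]] Kp nVp.
have clK : closed K by exact: compact_closed.
set Y := K `\` V; have Yp : Y p by [].
have clY : closed Y.
  by rewrite /Y setDE; apply: closedI => //; exact: open_closedC.
have cY : compact Y by exact: subclosed_compact clY cT (@subsetT _ _).
apply: contrapT => /nonemptyPn /disjoints_subset CV.
have [||F [[FY clF cF] Fp FV]] :=
  @quasi_component_nbhs _ _ (~` closure V) p hT cY Yp.
- by apply: closed_openC; exact: closed_closure.
- apply: subset_trans CV; apply: connected_component_max.
  + by move=> F [].
  + by move=> x; apply; split=> //; split=> //; rewrite setDv; exact: closed0.
  + exact: quasi_component_connected.
have : F = K.
  apply: ctdK; first by exists p.
    exists (~` ((Y `\` F) `|` closure V)).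
      by apply: closed_openC; apply: closedU => //; exact: closed_closure.
    apply/seteqP; split=> [x Fx|x [Kx nx]].
      by split; [have [] := FY x Fx|case=> [[]//|]; exact: FV].
    apply: contrapT => nFx; apply: (nx); left; split=> //; split=> // Vx.
    by apply: nx; right; exact: subset_closure.
  exists F => //; apply/seteqP; split=> [x Fx|x []//].
  by split=> //; have [] := FY x Fx.
by move=> FK; have [] := FY v; rewrite ?FK.
Qed.

Lemma continuumU (T : topologicalType) (K L : set T) :
  continuum K -> continuum L -> K `&` L !=set0 -> continuum (K `|` L).
Proof.
move=> [[x Kx] coK ctK] [_ coL ctL] KL; split; first by exists x; left.
  exact: compactU.
exact: connectedU.
Qed.

(** * Approximation of an indecomposable continuum by proper subcontinua *)

(** The composant of [p], that is the union of the proper subcontinua through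
    [p], is dense: the component of [p] outside a small neighborhood of [x]
    reaches the boundary of this neighborhood. *)
Lemma subcontinuum_meets (R : realType) (X : metricType R) (K : set X)
    (p x : X) (e : R) :
  compact [set: X] -> continuum K -> Defs.nondegenerate K ->
  K p -> K x -> 0 < e ->
  exists L, [/\ continuum L, L `<` K, L p & exists2 y, L y & mdist x y < e].
Proof.
move=> cX cK [a [b [Ka Kb ab]]] Kp Kx e0.
have hX : hausdorff_space X by exact: metric_hausdorff.
have [->|/eqP xp] := eqVneq x p.
  exists [set p]; split=> //.
  - by split; [exists p|exact: compact_set1|exact: connected1].
  - split; first by move=> _ ->.
    by move=> Kp1; apply: ab; rewrite (Kp1 a Ka) (Kp1 b Kb).
  - by exists p => //; rewrite mdistxx.
(* The radius is at most [mdist x p], so that [p] stays outside [V]. *)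
pose r := Num.min e (mdist x p).
have r0 : 0 < r by rewrite lt_min e0 mdist_gt0; exact/eqP.
have [B xB clB] := uniform_regular (nbhsx_ballx x r r0).
pose V := B°.
have clV : closure V `<=` ball x r.
  by apply: subset_trans clB; apply: closureS; exact: interior_subset.
have Vx : V x by exact: nbhs_singleton (nbhs_interior xB).
have nVp : ~ V p.
  move=> /subset_closure/clV; rewrite ballEmdist/= lt_min => /andP[_].
  by rewrite ltxx.
have oV : open V by exact: open_interior.
have KV : K `&` V !=set0 by exists x.
have [y [Cy Vy]] := boundary_bumping hX cX cK oV KV Kp nVp.
have [_ coK _] := cK; have clK : closed K by exact: compact_closed.
exists (connected_component (K `\` V) p); split.
- split; first by exists y.
    apply: subclosed_compact cX (@subsetT _ _); apply: component_closed.
    by rewrite setDE; apply: closedI => //; exact: open_closedC.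
  exact: component_connected.
- split; first by move=> z /connected_component_sub[].
  by move=> /(_ x Kx) /connected_component_sub[].
- by apply: connected_component_refl.
- exists y => //; move/clV: Vy; rewrite ballEmdist/= lt_min.
  by case/andP.
Qed.

(** By indecomposability the proper subcontinua of [K] through a fixed point [p]
    are directed under inclusion, so their tails form a filter [F]; since every
    point of [K] is within [e / 2] of some of them, the compactness of [K] yields
    one that is within [e] of all points at once. *)
Lemma indecomposable_approx (R : realType) (X : metricType R) (K : set X)
    (e : R) :
  compact [set: X] -> continuum K -> Defs.nondegenerate K -> ~ decomposable K ->
  0 < e ->
  exists L, [/\ continuum L, L `<` K &
    forall x, K x -> exists2 y, L y & mdist x y < e].
Proof.
move=> cX cK ndK indK e0; have [[p Kp] coK _] := cK.
pose D := [set L : set X | [/\ continuum L, L `<` K & L p]].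
pose F := filter_from D (fun L => [set M | D M /\ L `<=` M]).
have FF : ProperFilter F.
  apply: filter_from_proper; first apply: filter_from_filter.
  - have [L [cL LK Lp _]] := subcontinuum_meets cX cK ndK Kp Kp e0.
    by exists L.
  - move=> L M [cL LK Lp] [cM MK Mp]; exists (L `|` M).
      have cLM : continuum (L `|` M) by apply: continuumU => //; exists p.
      split; [by []| |by left]; split.
        by rewrite subUset; split; [exact: LK.1|exact: MK.1].
      move=> KLM; apply: indK; exists L, M; split=> //.
      by apply/seteqP; split=> // x [/LK.1|/MK.1].
    by move=> N [DN]; rewrite subUset => -[LN MN].
  - by move=> L DL; exists L; split.
have : \forall L \near F, K `<=` [set x | exists2 y, L y & mdist x y < e].
  have /compact_near_coveringP/(_ _ F (fun (L : set X) x =>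
    exists2 y, L y & mdist x y < e)) := coK.
  apply=> x Kx.
  have e20 : 0 < e / 2 by rewrite divr_gt0.
  have [L [cL LK Lp [y Ly xy]]] := subcontinuum_meets cX cK ndK Kp Kx e20.
  exists (ball x (e / 2), [set M | D M /\ L `<=` M]).
    by split; [exact: nbhsx_ballx|exists L].
  move=> [z M] /= [+ [DM LM]]; rewrite ballEmdist/= => xz.
  exists y; first exact: LM.
  by rewrite (le_lt_trans (metric_triangle z x y))// [e]splitr ltrD// metric_sym.
move=> FK; have [L [KL [cL LK Lp]]] : exists L,
    K `<=` [set x | exists2 y, L y & mdist x y < e] /\ D L.
  apply: (@filter_ex _ F); apply: filterI => //.
  have [L [cL LK Lp _]] := subcontinuum_meets cX cK ndK Kp Kp e0.
  by exists L => // M [].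
by exists L.
Qed.

(** * Ample and filament continua *)

Lemma ample_not_filament (T : topologicalType) (K : set T) :
  ample K -> ~ filament K.
Proof.
move=> [[[x Kx] _ _] aK] [_ [U [oU KU intU]]].
have [L [[_ _ ctL] KL LU]] := aK U oU KU.
suff : (connected_component U x)° x by rewrite intU.
have : nbhs x L by exact: KL.
apply: filterS; apply: connected_component_max => //.
exact: interior_subset (KL x Kx).
Qed.

Lemma sub_filament (T : topologicalType) (K L : set T) :
  continuum K -> K `<=` L -> filament L -> filament K.
Proof.
move=> cK KL [_ [U [oU LU intU]]]; split=> //; exists U; split=> //.
  exact: subset_trans LU.
by move=> x /KL; exact: intU.
Qed.

(** Take an open neighborhood of [K] whose closure misses a point [p] of [A].  The
    closure of its component is a continuum that meets [A] and misses [p], so by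
    terminality it lies in [A], which has no interior. *)
Lemma terminal_sub_filament (R : realType) (X : metricType R) (A K : set X) :
  compact [set: X] -> terminal A -> A° = set0 -> continuum K -> K `<` A ->
  filament K.
Proof.
move=> cX [_ tA] intA cK [KA nAK]; split=> //.
have /existsNP[p /not_implyP[Ap nKp]] := nAK.
have [_ coK _] := cK.
have clK : closed K by exact: compact_closed (@metric_hausdorff _ X) coK.
have pK : nbhs p (~` K) by apply: open_nbhs_nbhs; split=> //; exact: closed_openC.
have [B pB BK] := uniform_regular pK.
exists (~` closure B); split.
- by apply: closed_openC; exact: closed_closure.
- exact: subsetCr.
move=> x Kx; set C := connected_component _ x.
have Bx : (~` closure B) x by move/BK; apply.
have nCp : ~ closure C p.
  move=> /(_ _ pB)[z [/connected_component_sub Cz Bz]].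
  by apply: Cz; exact: subset_closure.
have Cx : C x by exact: connected_component_refl.
have clC : continuum (closure C).
  split; first by exists x; exact: subset_closure.
    exact: subclosed_compact (@closed_closure _ C) cX (@subsetT _ _).
  by apply: connected_closure; exact: component_connected.
rewrite -subset0 -intA; apply: interiorS.
have [||AC] := tA (closure C) clC.
- by exists x; split; [exact: KA|exact: subset_closure].
- by move/(_ p Ap).
by apply: subset_trans AC; exact: subset_closure.
Qed.

(** * The Hausdorff metric *)

Lemma hyperspace_mdist_le (R : realType) (X : metricType R)
    (K L : hyperspace X) (e : R) :
  (forall x, hyperset K x -> exists2 y, hyperset L y & mdist x y <= e) ->
  (forall y, hyperset L y -> exists2 x, hyperset K x & mdist y x <= e) ->
  mdist K L <= e.
Proof.
move=> KL LK; change (hausdorff_dist K L <= e).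
have [K0 _ _] := hyperset_continuum K; have [L0 _ _] := hyperset_continuum L.
rewrite /hausdorff_dist ge_max; apply/andP; split; apply: excess_le => // x Hx.
  by have [y Ly xy] := KL x Hx; apply: le_trans xy; exact: point_dist_le.
by have [y Ly xy] := LK x Hx; apply: le_trans xy; exact: point_dist_le.
Qed.

Lemma hyperspace_mdist_lt (R : realType) (X : metricType R)
    (K L : hyperspace X) (e : R) (x : X) :
  mdist K L < e -> hyperset K x -> exists2 y, hyperset L y & mdist x y < e.
Proof.
move=> KLe Kx; have cK := hyperset_continuum K; have cL := hyperset_continuum L.
have [L0 _ _] := cL.
have : point_dist x L < e.
  apply: le_lt_trans (excess_ge cK cL Kx) _; apply: le_lt_trans KLe.
  change (excess K L <= hausdorff_dist K L).
  by rewrite /hausdorff_dist le_max lexx.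
by move=> /(inf_lt (point_dist_has_inf x L0).1)[_ [y Ly <-] xy]; exists y.
Qed.

(** * Fibers of open and of monotone maps *)

(** Fibers over points near [y0] stay close to the fiber of [y0] because [f] is
    closed, and they come close to every point of it because [f] is open; the
    compactness of the fiber of [y0] makes the second estimate uniform. *)
Lemma fibers_continuous (R : realType) (X : metricType R) (Y : topologicalType)
    (f : X -> Y) (y0 : Y) (e : R) :
  compact [set: X] -> hausdorff_space Y -> continuous f -> open_map f ->
  0 < e ->
  \forall y \near y0,
    (forall x, f x = y -> exists2 x', f x' = y0 & mdist x x' < e) /\
    (forall x, f x = y0 -> exists2 x', f x' = y & mdist x x' < e).
Proof.
move=> cX hY cf of_ e0.
pose N := [set x | exists2 x', f x' = y0 & mdist x x' < e].
have upper : \forall y \near y0, ~ (f @` (~` N°)) y.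
  apply: open_nbhs_nbhs; split.
    apply: closed_openC; apply: closed_map_compact => //.
    by apply: open_closedC; exact: open_interior.
  move=> [x nNx fx]; apply: nNx.
  apply: filterS (nbhsx_ballx x e e0) => z; rewrite ballEmdist/= => xz.
  by exists x => //; rewrite metric_sym.
have lower : \forall y \near y0,
    f @^-1` [set y0] `<=` [set x | exists2 x', f x' = y & mdist x x' < e].
  have cfib : compact (f @^-1` [set y0]).
    apply: subclosed_compact cX (@subsetT _ _).
    move/continuous_closedP: cf; apply.
    by apply: compact_closed => //; exact: compact_set1.
  have /compact_near_coveringP/(_ _ (nbhs y0) (fun y x =>
    exists2 x', f x' = y & mdist x x' < e)) := cfib.
  apply=> x /= fx; have e20 : 0 < e / 2 by rewrite divr_gt0.
  exists (ball x (e / 2), f @` (ball x (e / 2))°).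
    split; first exact: nbhsx_ballx.
    apply: open_nbhs_nbhs; split; first by apply: of_; exact: open_interior.
    by exists x => //; exact: nbhsx_ballx.
  move=> [z y]/= [+ [x' /interior_subset + <-]]; rewrite ballEmdist/= => xz xx'.
  exists x' => //; rewrite (le_lt_trans (metric_triangle z x x'))//.
  by rewrite [e]splitr ltrD// metric_sym.
near=> y; split; last by move=> x fx; exact: (near lower y).
move=> x fx; apply: contrapT => nN; apply: (near upper y) => //.
by exists x => // /interior_subset.
Unshelve. all: by end_near. Qed.

(** Each fiber lies on one side of a separation of the preimage, so the two sides
    have disjoint images, closed because [f] is closed: they separate [J]. *)
Lemma monotone_preimage_continuum (T U : topologicalType) (f : T -> U)
    (J : set U) :
  compact [set: T] -> hausdorff_space U -> continuous f ->
  (forall y, continuum (f @^-1` [set y])) -> continuum J ->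
  continuum (f @^-1` J).
Proof.
move=> cT hU cf cfib [[y0 Jy0] cJ ctJ].
have clJ : closed J by exact: compact_closed.
have clfJ : closed (f @^-1` J) by move/continuous_closedP: cf; apply.
split.
- by have [[x fx] _ _] := cfib y0; exists x; rewrite /preimage/= fx.
- exact: subclosed_compact clfJ cT (@subsetT _ _).
apply/connectedP => E [E0 JE sE].
have cl0 := separated_closed clfJ JE sE.
have cl1 : closed (E true).
  by apply: (separated_closed clfJ (B := E false));
    [rewrite JE setUC|rewrite separatedC].
have dE z : E false z -> E true z -> False.
  move=> Efz Etz; have : (E false `&` E true) z by [].
  by rewrite separated_disjoint.
have fib y : J y ->
    (f @^-1` [set y] `<=` E false) \/ (f @^-1` [set y] `<=` E true).
  move=> Jy; apply: (connected_subset sE); last by have [] := cfib y.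
  by rewrite -JE => z /= fz; rewrite /preimage/= fz.
have dfE z : ~ ((f @` E false) z /\ (f @` E true) z).
  move=> [[a Ea fa] [b Eb fb]].
  have Jz : J z.
    have : (f @^-1` J) a by rewrite JE; left.
    by rewrite /preimage/= fa.
  by case: (fib z Jz) => sub; [apply: (dE b)|apply: (dE a)] => //; exact: sub.
move/connectedP: ctJ => /(_ (fun b => f @` E b)); apply; split.
- by move=> b; have [x Ex] := E0 b; exists (f x), x.
- apply/seteqP; split=> y.
    move=> Jy; have [[x fx] _ _] := cfib y.
    have : (f @^-1` J) x by rewrite /preimage/= fx.
    by rewrite JE => -[Ex|Ex]; [left|right]; exists x.
  by case=> -[x Ex <-]; suff : (f @^-1` J) x by []; rewrite JE; [left|right].
- split; rewrite -(closure_id _).1; try exact: closed_map_compact.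
    by rewrite -subset0 => z [? ?]; apply: (dfE z).
  by rewrite -subset0 => z [? ?]; apply: (dfE z).
Qed.

Lemma preimage_interior_empty (T U : topologicalType) (f : T -> U) (y : U) :
  open_map f -> ~ open [set y] -> (f @^-1` [set y])° = set0.
Proof.
move=> of_ ny; rewrite -subset0 => x fx; apply: ny.
have := of_ _ (@open_interior _ (f @^-1` [set y])).
rewrite (_ : f @` _ = [set y])//; apply/seteqP; split=> z.
  by move=> [a /interior_subset + <-].
by move=> ->; exists x => //; exact: interior_subset fx.
Qed.

(** An open set around a fiber contains the preimage of a neighborhood of [y],
    because [f] is closed, and the preimage of a continuum is a continuum. *)
Lemma fiber_ample (T U : topologicalType) (f : T -> U) (y : U) :
  compact [set: T] -> hausdorff_space U -> continuous f ->
  (forall z, continuum (f @^-1` [set z])) ->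
  (forall B, nbhs y B -> exists J, [/\ continuum J, nbhs y J & J `<=` B]) ->
  ample (f @^-1` [set y]).
Proof.
move=> cT hU cf cfib lc; split=> // O oO fO.
have [|J [cJ yJ JO]] := lc (~` (f @` (~` O))).
  apply: open_nbhs_nbhs; split.
    by apply: closed_openC; apply: closed_map_compact => //; exact: open_closedC.
  by move=> [x nOx fx]; apply: nOx; exact: fO.
exists (f @^-1` J); split.
- exact: monotone_preimage_continuum.
- by move=> x fx; apply: cf; rewrite fx.
- by move=> x /JO nfx; apply: contrapT => nOx; apply: nfx; exists x.
Qed.

(** * The unit circle *)

Lemma cos_lt1 (R : realType) (t : R) : 0 < t < 2 * pi -> cos t < 1.
Proof.
move=> /andP[t0 t2].
have : 0 < sin (t / 2).
  by apply: sin_gt0_pi; rewrite divr_gt0//= ltr_pdivrMr// mulrC.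
move=> s0; rewrite (_ : t = (t / 2) *+ 2); last by rewrite -mulr_natr divfK.
have := cos2Dsin2 (t / 2); have : 0 < sin (t / 2) ^+ 2 by rewrite exprn_gt0.
rewrite cos_mulr2n mulr2n; lra.
Qed.

Section CircleTopology.
Variable R : realType.
Local Notation S1 := (unit_circle R).

Lemma expi_eqE (a b : R) :
  expi a = expi b <-> cos a = cos b /\ sin a = sin b.
Proof.
split=> [/(congr1 val)[]//|[ab1 ab2]].
by apply: val_inj; rewrite /= ab1 ab2.
Qed.

Lemma expi_neq (a b : R) : 0 < b - a < 2 * pi -> expi a <> expi b.
Proof.
move=> /cos_lt1 ab /expi_eqE[cab sab]; move: ab.
by rewrite cosB cab sab -!expr2 cos2Dsin2 ltxx.
Qed.

Lemma expi_periodic (a : R) : expi (a - 2 * pi) = expi a.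
Proof.
by rewrite -[in RHS](subrK (2 * pi) a); apply/esym/expi_eqE; split;
  rewrite mulr_natl (cosD2pi, sinD2pi).
Qed.

(** The polar angle of [z] counted from [a], obtained from [acos] after rotating
    [z] by [- a]. *)
Lemma expi_onto (a : R) (z : S1) :
  exists t, [/\ 0 <= t, t < 2 * pi & expi (a + t) = z].
Proof.
case: z => -[u v] uvS; have /= uv1 := set_mem uvS.
(* The angle [t] of the point [(u + i v) * e^(- i a)]. *)
have rot : exists t, [/\ 0 <= t, t < 2 * pi,
    cos t = u * cos a + v * sin a & sin t = v * cos a - u * sin a].
  have ca := cos2Dsin2 a; have pi0 := pi_gt0 R.
  set x := u * cos a + v * sin a; set y := v * cos a - u * sin a.
  have xy1 : x ^+ 2 + y ^+ 2 = 1.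
    transitivity ((u ^+ 2 + v ^+ 2) * (cos a ^+ 2 + sin a ^+ 2)).
      by rewrite /x /y; ring.
    by rewrite uv1 ca mulr1.
  have x1 : -1 <= x <= 1.
    by have y2 := sqr_ge0 y; apply/andP; split; nra.
  have sx : sin (acos x) = `|y|.
    by rewrite sin_acos// (_ : 1 - x ^+ 2 = y ^+ 2) ?sqrtr_sqr//; lra.
  have [y0|y0] := leP 0 y.
    exists (acos x); split; rewrite ?acos_ge0 ?acosK ?sx ?ger0_norm//.
    by have := acos_lepi x1; lra.
  have x0 : 0 < acos x.
    by rewrite lt_neqAle acos_ge0// andbT; apply/eqP => ax; move: sx;
      rewrite -ax sin0 => /esym/normr0_eq0; lra.
  exists (2 * pi - acos x); split.
  - by have := acos_lepi x1; lra.
  - lra.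
  - by rewrite addrC mulr_natl cosD2pi cosN acosK.
  - by rewrite addrC mulr_natl sinD2pi sinN sx ltr0_norm// opprK.
have [t [t0 t2 ct st]] := rot; exists t; split=> //.
apply: val_inj; rewrite /= cosD sinD ct st.
have ca := cos2Dsin2 a.
by congr pair; rewrite -[RHS]mulr1 -ca; ring.
Qed.

Lemma expi_continuous : continuous (@expi R).
Proof.
apply: continuous_comp_initial => x.
exact: (cvg_pair (@continuous_cos R x) (@continuous_sin R x)).
Qed.

Lemma circle_hausdorff : hausdorff_space S1.
Proof.
have cval : continuous (set_val : S1 -> R * R) by exact: initial_continuous.
have c1 : continuous (fun z : S1 => (set_val z).1).
  by move=> z; apply: continuous_comp (cval z) _; exact: cvg_fst.
have c2 : continuous (fun z : S1 => (set_val z).2).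
  by move=> z; apply: continuous_comp (cval z) _; exact: cvg_snd.
move=> p q pq; apply: val_inj.
have e1 := continuous_eq_cluster (@Rhausdorff R) c1 pq.
have e2 := continuous_eq_cluster (@Rhausdorff R) c2 pq.
exact: injective_projections.
Qed.

Lemma arc_continuum (a b : R) : a <= b -> continuum (@expi R @` `[a, b]).
Proof.
move=> ab; have ce : {within `[a, b], continuous (@expi R)}.
  by apply: continuous_subspaceT; exact: expi_continuous.
split.
- by exists (expi a), a => //=; rewrite in_itv/= lexx.
- by apply: continuous_compact => //; exact: segment_compact.
- by apply: connected_continuous_connected => //; exact: segment_connected.
Qed.

(** The interval from [a + d] to [a + 2 * pi - d] has a compact image that
    misses [expi a], and every point off this image has an argument within [d]
    of [a]. *)
Lemma arc_nbhs (a d : R) : 0 < d -> nbhs (expi a) (@expi R @` `[a - d, a + d]).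
Proof.
move=> d0.
have far : nbhs (expi a) (~` (@expi R @` `[a + d, a + 2 * pi - d])).
  apply: open_nbhs_nbhs; split.
    apply: closed_openC; apply: compact_closed; first exact: circle_hausdorff.
    apply: continuous_compact; last exact: segment_compact.
    by apply: continuous_subspaceT; exact: expi_continuous.
  move=> [t /=]; rewrite in_itv/= => /andP[t1 t2] /esym; apply: expi_neq; lra.
apply: filterS far => z nz; have [t [t0 t2 tz]] := expi_onto a z.
have [td|td] := leP t d.
  by exists (a + t) => //=; rewrite in_itv/=; lra.
have [tp|tp] := leP t (2 * pi - d).
  by exfalso; apply: nz; exists (a + t) => //=; rewrite in_itv/=; lra.
exists (a + t - 2 * pi); last by rewrite expi_periodic.
by rewrite /= in_itv/=; lra.
Qed.

Lemma circle_locally_continuum (z : S1) (B : set S1) : nbhs z B ->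
  exists J, [/\ continuum J, nbhs z J & J `<=` B].
Proof.
have [t [_ _ <-]] := expi_onto 0 z; rewrite add0r => /expi_continuous.
move=> /nbhs_ballP[e /= e0 eB].
exists (@expi R @` `[t - e / 2, t + e / 2]); split.
- by apply: arc_continuum; lra.
- by apply: arc_nbhs; lra.
- move=> _ [s /= + <-]; rewrite in_itv/= => /andP[s1 s2]; apply: eB.
  by rewrite /ball/= ltr_norml; lra.
Qed.

Lemma circle_no_isolated (z : S1) : ~ open [set z].
Proof.
have [t [_ _ <-]] := expi_onto 0 z; rewrite add0r => oz.
have : nbhs t (@expi R @^-1` [set expi t]).
  by apply: expi_continuous; exact: open_nbhs_nbhs.
move=> /nbhs_ballP[e /= e0 eB].
have pi0 := pi_gt0 R.
pose d := Num.min (e / 2) pi.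
have d0 : 0 < d by rewrite lt_min divr_gt0//=.
have de : d <= e / 2 by rewrite ge_min lexx.
have dp : d <= pi by rewrite ge_min lexx orbT.
have : (@expi R @^-1` [set expi t]) (t + d).
  by apply: eB; rewrite /ball/= ltr_norml; lra.
by move=> /esym; apply: expi_neq; lra.
Qed.

Lemma expi_image0_2pi : @expi R @` `[0, 2 * pi[ = [set: S1].
Proof.
rewrite -subTset => z _; have [t [t0 t2 <-]] := expi_onto 0 z; rewrite add0r.
by exists t => //=; rewrite in_itv/= t0.
Qed.

Lemma circle_continuum : continuum [set: S1].
Proof.
rewrite -expi_image0_2pi.
rewrite (_ : @expi R @` `[0, 2 * pi[ = @expi R @` `[0, 2 * pi]).
  by apply: arc_continuum; have := pi_gt0 R; lra.
apply/seteqP; split; last by rewrite expi_image0_2pi.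
move=> _ [t + <-]; rewrite /= in_itv/= => /andP[t0 /ltW t2].
by exists t => //=; rewrite in_itv/= t0.
Qed.

End CircleTopology.

(** * The Planck boundary of a space fibered into terminal continua *)

Section TerminalFibers.
Context {R : realType} {X : metricType R} {Y : topologicalType} {f : X -> Y}.
Hypotheses (cX : compact [set: X]) (hY : hausdorff_space Y).
Hypotheses (atomic_f : atomic f) (open_f : open_map f).
Hypothesis nonisolated : forall y : Y, ~ open [set y].
Hypothesis locally_continuum : forall (y : Y) (B : set Y), nbhs y B ->
  exists J, [/\ continuum J, nbhs y J & J `<=` B].
Local Notation fiber y := (f @^-1` [set y]).

Let fiber_continuum y : continuum (fiber y).
Proof. by have [_ /(_ y)[]] := atomic_f. Qed.

Let ample_fiber y : ample (fiber y).
Proof.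
have [cf _] := atomic_f.
apply: fiber_ample => //; exact: locally_continuum.
Qed.

(** By terminality, a continuum that does not lie properly in the fiber of one of
    its points contains it; it is then not filament, since this fiber is
    ample. *)
Lemma filament_fiberP (K : set X) : continuum K ->
  filament K <-> exists y, K `<` fiber y.
Proof.
move=> cK; split=> [fK|[y Ky]]; last first.
  apply: terminal_sub_filament Ky => //; first by have [_] := atomic_f.
  exact: preimage_interior_empty.
have [[x Kx] _ _] := cK; exists (f x).
have nsub : ~ (fiber (f x) `<=` K).
  move=> sub; apply: ample_not_filament (ample_fiber (f x)) _.
  exact: sub_filament sub fK.
split=> //.
have [_ /(_ (f x))[_ tf]] := atomic_f.
by have [|/nsub|] := tf K cK; first by exists x.
Qed.

Lemma ample_fiber_sub (K : set X) (x : X) : ample K -> K x -> fiber (f x) `<=` K.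
Proof.
move=> aK Kx; apply: contrapT => nsub; have [cK _] := aK.
apply: ample_not_filament aK _; apply/filament_fiberP => //.
exists (f x); split=> //; have [_ /(_ (f x))[_ tf]] := atomic_f.
by have [|/nsub|] := tf K cK; first by exists x.
Qed.

Lemma minimal_ample_fiberP (K : set X) :
  minimal_ample K <-> exists y, K = fiber y.
Proof.
split=> [[aK minK]|[y ->]].
  have [[[x Kx] _ _] _] := aK; exists (f x).
  apply: contrapT => nK; apply: (minK (fiber (f x))) (ample_fiber _).
  have sub := ample_fiber_sub aK Kx; split=> // KA.
  by apply: nK; apply/seteqP.
split=> // L Ly aL; apply: (ample_not_filament aL).
by have [cL _] := aL; apply/filament_fiberP => //; exists y.
Qed.

(** Two points of [K] are limits of pairs of points of filament continua, and
    each such pair lies in a single fiber. *)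
Lemma closure_filaments_fiber (K : hyperspace X) (x y : X) :
  closure (filaments X) K -> hyperset K x -> hyperset K y -> f x = f y.
Proof.
move=> clK Kx Ky; have [cf _] := atomic_f.
apply: hY => A B xA yB.
have /nbhs_ballP[d /= d0 dA] := cf _ _ xA.
have /nbhs_ballP[e /= e0 eB] := cf _ _ yB.
have r0 : 0 < Num.min d e by rewrite lt_min d0.
have [L [fL]] := clK _ (nbhsx_ballx K _ r0).
rewrite ballEmdist/= => KL.
have /(filament_fiberP (hyperset_continuum L))[w [Lw _]] := fL.
have [x' Lx' xx'] := hyperspace_mdist_lt KL Kx.
have [y' Ly' yy'] := hyperspace_mdist_lt KL Ky.
move: xx' yy'; rewrite !lt_min => /andP[xx' _] /andP[_ yy'].
exists w; split.
  by rewrite -(Lw x' Lx'); apply: dA; rewrite ballEmdist.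
by rewrite -(Lw y' Ly'); apply: eB; rewrite ballEmdist.
Qed.

Hypothesis fiber_nondegenerate : forall y, Defs.nondegenerate (fiber y).
Hypothesis fiber_indecomposable : forall y, ~ decomposable (fiber y).

Lemma fiber_closure_filaments (K : hyperspace X) (y : Y) :
  hyperset K = fiber y -> closure (filaments X) K.
Proof.
move=> Ky B /nbhs_ballP[e /= e0 eB].
have e20 : 0 < e / 2 by rewrite divr_gt0.
have [L [cL Ly Lapprox]] := indecomposable_approx cX (fiber_continuum y)
  (fiber_nondegenerate y) (@fiber_indecomposable y) e20.
exists (Hyperspace cL); split.
  by apply/(filament_fiberP cL); exists y.
apply: eB; rewrite ballEmdist/=.
apply: (@le_lt_trans _ _ (e / 2)); last by rewrite ltr_pdivrMr// ltr_pMr// ltr1n.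
apply: hyperspace_mdist_le => /= x; rewrite Ky => Hx.
  by have [z Lz xz] := Lapprox x Hx; exists z => //; exact: ltW.
by exists x; [exact: Ly.1|rewrite mdistxx ltW].
Qed.

Lemma planck_boundary_fiberP (K : hyperspace X) :
  planck_boundary X K <-> exists y, hyperset K = fiber y.
Proof.
split=> [[aK clK]|[y Ky]]; last first.
  split; last exact: fiber_closure_filaments Ky.
  by rewrite /amples/= Ky.
have [[x Kx] _ _] := hyperset_continuum K; exists (f x); apply/seteqP; split.
  by move=> z Kz; exact: (closure_filaments_fiber clK Kz Kx).
exact: ample_fiber_sub.
Qed.

Definition fiber_point (y : Y) : hyperspace X := Hyperspace (fiber_continuum y).

Lemma fiber_point_continuous : continuous fiber_point.
Proof.
move=> y B /nbhs_ballP[e /= e0 eB].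
have e20 : 0 < e / 2 by rewrite divr_gt0.
have [cf _] := atomic_f.
apply: filterS (fibers_continuous y cX hY cf open_f e20) => z [zy yz].
apply: eB; rewrite ballEmdist/=.
apply: (@le_lt_trans _ _ (e / 2)); last by rewrite ltr_pdivrMr// ltr_pMr// ltr1n.
apply: hyperspace_mdist_le => x /= fx.
  by have [x' fx' xx'] := yz x fx; exists x' => //; exact: ltW.
by have [x' fx' xx'] := zy x fx; exists x' => //; exact: ltW.
Qed.

Lemma planck_boundary_continuum : continuum [set: Y] ->
  continuum (planck_boundary X).
Proof.
move=> [[y0 _] cY ctY].
have -> : planck_boundary X = fiber_point @` [set: Y].
  apply/seteqP; split=> K.
    move=> /planck_boundary_fiberP[y Ky]; exists y => //.
    exact/esym/hyperset_inj.
  by move=> [y _ <-]; apply/planck_boundary_fiberP; exists y.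
have cfp : {within [set: Y], continuous fiber_point}.
  by apply: continuous_subspaceT; exact: fiber_point_continuous.
split; first by exists (fiber_point y0), y0.
  exact: continuous_compact.
exact: connected_continuous_connected.
Qed.

End TerminalFibers.

(** * Circles of pseudo-arcs *)

Theorem theorem7p1 (R : realType) (Psi : metricType R)
    (Pi : Psi -> unit_circle R)
    (Psi_circle : circle_of_pseudo_arcs Psi)
    (Pi_fibration : pseudo_arc_fibration Pi) :
  let P (alpha : R) : set Psi := Pi @^-1` [set expi alpha] in
  [/\ continuum (planck_boundary Psi),
      planck_boundary Psi = [set K : hyperspace Psi | minimal_ample K] &
      [set hyperset K | K in planck_boundary Psi]
        = [set P alpha | alpha in `[0, 2 * pi[]].
Proof.
move=> P; have [[_ cPsi _] _ _ _ _] := Psi_circle.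
have [atomic_Pi open_Pi arc_Pi] := Pi_fibration.
have ndPi y : Defs.nondegenerate (Pi @^-1` [set y]) by have [] := arc_Pi y.
have inPi y : ~ decomposable (Pi @^-1` [set y]).
  by have [cy _ _ hy] := arc_Pi y; exact: hy.
have planckP := planck_boundary_fiberP cPsi (@circle_hausdorff R) atomic_Pi open_Pi
  (@circle_no_isolated R) (@circle_locally_continuum R) ndPi inPi.
have minP := minimal_ample_fiberP cPsi (@circle_hausdorff R) atomic_Pi open_Pi
  (@circle_no_isolated R) (@circle_locally_continuum R).
split.
- apply: (planck_boundary_continuum cPsi (@circle_hausdorff R) atomic_Pi open_Pi
    (@circle_no_isolated R) (@circle_locally_continuum R) ndPi inPi).
  exact: circle_continuum.
- apply/seteqP; split=> K; first by move/planckP/minP.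
  by move/minP/planckP.
- apply/seteqP; split=> A.
    move=> [K /planckP[y Ky] <-].
    have : (@expi R @` `[0, 2 * pi[) y by rewrite expi_image0_2pi.
    by move=> [t t2 ty]; exists t => //; rewrite Ky -ty.
  move=> [t _ <-].
  have cP : continuum (P t) by have [] := arc_Pi (expi t).
  by exists (Hyperspace cP) => //; apply/planckP; exists (expi t).
Qed.
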